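(* There is an equilateral set of $58$ points in $\ell_5^{56}$; that is, there exist $58$ distinct points $x^{(1)},\dots,x^{(58)}\in\mathbb{R}^{56}$ such that the distances $\lVert x^{(i)}-x^{(j)}\rVert_5$, $1\le i<j\le 58$, are all equal. Consequently $e(\ell_5^{56})\ge 58>57=56+1$, so the assertion (Kusner's conjecture) that $e(\ell_p^n)=n+1$ for all positive integers $n$ and all real $p$ with $2<p<\infty$ is false.
   Context: For $1\le p<\infty$, $\ell_p^n$ denotes $\mathbb{R}^n$ with the norm $\lVert x\rVert_p=\left(\sum_{r=1}^n |x_r|^p\right)^{1/p}$. A set of points in a normed space is equilateral if the distance between every two distinct points of the set is the same. For a finite-dimensional normed space $X$, $e(X)$ denotes the largest size of an equilateral set in $X$. *)

(* Defs.v *)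
From HB Require Import structures.
From mathcomp Require Import all_boot all_order all_algebra.
From mathcomp Require Import all_classical all_reals all_analysis.
From mathcomp Require Import ring lra.

Set Implicit Arguments.
Unset Strict Implicit.
Unset Printing Implicit Defensive.

Import Order.TTheory GRing.Theory Num.Theory.

Local Open Scope classical_set_scope.
Local Open Scope card_scope.
Local Open Scope ring_scope.

(* The library norm `|x| on 'rV[R]_n is the sup norm,
   hence the explicit definition of the p-norm. *)
Definition lpnorm (R : realType) (n : nat) (p : R) (x : 'rV[R]_n) : R :=
  (\sum_(r < n) `|x ord0 r| `^ p) `^ p^-1.

(* N plays the role of the norm of the space V. *)
Definition equilateral (R : realType) (V : zmodType) (N : V -> R)
    (A : set V) : Prop :=
  exists d : R, forall x y, A x -> A y -> x <> y -> N (x - y) = d.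

(* The comparison with B is between cardinals, so B may a priori be infinite. *)
Definition is_largest_equilateral_size (R : realType) (V : zmodType)
    (N : V -> R) (m : nat) : Prop :=
  (exists A : set V, equilateral N A /\ A #= `I_m) /\
  (forall B : set V, equilateral N B -> B #<= `I_m).

(* The default value 0 is never used when N is an l_p norm on R^n:
   see equilateral_numberP below. *)
Definition equilateral_number (R : realType) (V : zmodType) (N : V -> R) : nat :=
  xget 0%N [set m | is_largest_equilateral_size N m].

Definition e_lp (R : realType) (n : nat) (p : R) : nat :=
  equilateral_number (@lpnorm R n p).

Lemma lpnorm_coord (R : realType) (n : nat) (p : R) (x : 'rV[R]_n) (r : 'I_n) :
  0 < p -> `|x ord0 r| <= lpnorm p x.
Proof.
move=> p0; rewrite /lpnorm.
have -> : `|x ord0 r| = (`|x ord0 r| `^ p) `^ p^-1.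
  by rewrite -powRrM mulfV ?gt_eqF// powRr1.
apply: ge0_ler_powR; rewrite ?nnegrE ?invr_ge0 ?powR_ge0 ?(ltW p0)//.
  by apply: sumr_ge0 => i _; exact: powR_ge0.
by rewrite (bigD1 r)//= lerDl; apply: sumr_ge0 => i _; exact: powR_ge0.
Qed.

Lemma lpnorm_le (R : realType) (n : nat) (p c : R) (x : 'rV[R]_n) :
  0 < p -> 0 <= c -> (forall r, `|x ord0 r| <= c) ->
  lpnorm p x <= n%:R `^ p^-1 * c.
Proof.
move=> p0 c0 xc; rewrite /lpnorm.
have -> : c = (c `^ p) `^ p^-1 by rewrite -powRrM mulfV ?gt_eqF// powRr1.
rewrite -powRM ?powR_ge0//.
apply: ge0_ler_powR; rewrite ?nnegrE ?invr_ge0 ?(ltW p0)//.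
- by apply: sumr_ge0 => i _; exact: powR_ge0.
- by rewrite mulr_ge0 ?powR_ge0.
rewrite mulr_natl -[in leRHS](card_ord n) -sumr_const; apply: ler_sum => i _.
by apply: ge0_ler_powR; rewrite ?nnegrE// ltW.
Qed.

Lemma equilateral_lp_bounded (R : realType) (n : nat) (p : R) : 0 < p ->
  exists K : nat, forall A : set 'rV[R]_n,
    equilateral (lpnorm p) A -> A #<= `I_K.
Proof.
move=> p0.
pose k := (Num.truncn (n%:R `^ p^-1 : R)).+1.
have kP : n%:R `^ p^-1 < k%:R :> R by exact: truncnS_gt.
have k0 : 0 < k%:R :> R by rewrite ltr0n.
pose T : finType := {ffun 'I_n -> 'I_(2 * k).+1}.
exists #|T|%N => A [d dP].
have [->|/set0P[x0 Ax0]] := eqVneq A set0; first exact: card_ge0.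
pose g (x : 'rV[R]_n) (r : 'I_n) : R := (x ord0 r - x0 ord0 r + d) / d * k%:R.
pose f (x : 'rV[R]_n) : nat :=
  enum_rank ([ffun r => inord (Num.truncn (g x r))] : T).
suff f_inj : {in A &, injective f}.
  rewrite -(card_le_eql (inj_card_eq f_inj)); apply: subset_card_le.
  by move=> _ [x _ <-] /=; exact: ltn_ord.
move=> x y; rewrite !inE => Ax Ay fxy; apply: contrapT => xNy.
have dE : lpnorm p (x - y) = d by exact: dP.
have d_ge0 : 0 <= d by rewrite -dE powR_ge0.
have d_gt0 : 0 < d.
  rewrite lt_neqAle d_ge0 andbT eq_sym; apply/eqP => d0; apply: xNy.
  apply/rowP => r; apply/eqP; rewrite -subr_eq0 -normr_le0.
  by rewrite -[leRHS]d0 -dE; have := lpnorm_coord (x - y) r p0; rewrite !mxE.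
have g_bnd z r : A z -> 0 <= g z r <= 2 * k%:R.
  move=> Az; have : `|z ord0 r - x0 ord0 r| <= d.
    have [->|/eqP zx0] := eqVneq z x0; first by rewrite subrr normr0.
    rewrite -(dP z x0)//.
    by have := lpnorm_coord (z - x0) r p0; rewrite !mxE.
  rewrite ler_norml => /andP[h1 h2].
  rewrite /g; apply/andP; split.
    by rewrite mulr_ge0 ?divr_ge0 ?(ltW k0)//; lra.
  by rewrite ler_pM2r// ler_pdivrMr//; lra.
have fE r : Num.truncn (g x r) = Num.truncn (g y r).
  have /ffunP/(_ r) : ([ffun r => inord (Num.truncn (g x r))] : T)
                     = [ffun r => inord (Num.truncn (g y r))].
    exact/enum_rank_inj/val_inj.
  rewrite !ffunE => /(congr1 val) /=.
  have tr z : A z -> (Num.truncn (g z r) < (2 * k).+1)%N.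
    move=> /(g_bnd _ r)/andP[g0 g1].
    rewrite ltnS -(ler_nat R) natrM.
    by apply: le_trans g1; rewrite truncn_le.
  by rewrite !inordK ?tr.
have xy_small r : `|(x - y) ord0 r| <= d / k%:R.
  have /andP[gx0 _] := g_bnd x r Ax; have /andP[gy0 _] := g_bnd y r Ay.
  have gxy : `|g x r - g y r| <= 1.
    have /andP[] := truncn_itv gx0; have /andP[] := truncn_itv gy0.
    rewrite fE -natr1 => a1 a2 a3 a4; rewrite ler_norml; apply/andP; split; lra.
  rewrite ler_pdivlMr// -[k%:R]gtr0_norm// -normrM.
  have -> : (x - y) ord0 r * k%:R = d * (g x r - g y r).
    by rewrite !mxE /g; field; rewrite gt_eqF.
  by rewrite normrM gtr0_norm// ler_piMr.
have : d < d.
  rewrite -[ltLHS]dE; apply: le_lt_trans (lpnorm_le p0 _ xy_small) _.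
    by rewrite divr_ge0 // ltW.
  by rewrite mulrCA gtr_pMr// ltr_pdivrMr// mul1r.
by rewrite ltxx.
Qed.

Lemma equilateral_numberP (R : realType) (n : nat) (p : R) : 0 < p ->
  is_largest_equilateral_size (@lpnorm R n p) (e_lp n p).
Proof.
move=> p0; rewrite /e_lp /equilateral_number; apply: xgetPex.
have [K KP] := equilateral_lp_bounded n p0.
pose P : pred nat := fun m =>
  `[< exists A : set 'rV[R]_n, equilateral (lpnorm p) A /\ A #= `I_m >].
have exP : exists m, P m.
  exists 0%N; apply/asboolP; exists set0; split; first by exists 0.
  by rewrite II0.
have ubP m : P m -> (m <= K)%N.
  move=> /asboolP[A [eA Am]].
  by rewrite -card_le_II -(card_le_eql Am); exact: KP.
case: (ex_maxnP exP ubP) => m /asboolP Pm mmax.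
exists m; split => // B eB.
have /finite_setP[k Bk] : finite_set B.
  exact: card_le_finite (KP _ eB) (finite_II K).
rewrite (card_le_eql Bk) card_le_II; apply: mmax.
by apply/asboolP; exists B.
Qed.

(* Main.v *)
(* All coordinates of the 58 points are taken among fourteen reals x_0, ...,
   x_13, placed according to a fixed 58 x 56 pattern built from the quadratic
   residues mod 7. The symmetry of the pattern leaves only twelve distinct
   equations "fifth power of the distance = T" in the x_a. Their Jacobian has
   rank 12 at a numerical solution, which is therefore the approximation of an
   exact one: a Newton-like map v |-> v - G(v) with a frozen approximate inverse
   Jacobian is a contraction of the unit ball of R^12. The points are scaled so
   that the numerical solution, the approximate inverse and all error bounds
   are integers; both the bounds and the twelve equations are then checked by
   computation. *)

From HB Require Import structures.
From Stdlib Require Import ZArith.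
Require Import Defs.
From mathcomp Require Import all_boot all_order all_algebra.
From mathcomp Require Import all_classical all_reals all_analysis.
From mathcomp Require Import ring lra zify ssrZ.
Import Order.TTheory GRing.Theory Num.Theory.
Import numFieldNormedType.Exports.
Set Implicit Arguments.
Unset Strict Implicit.
Unset Printing Implicit Defensive.
Local Open Scope classical_set_scope.
Local Open Scope card_scope.
Local Open Scope ring_scope.

(** * Zeros of maps close to the identity *)

Lemma rowv_norm_le (R : realType) n (v : 'rV[R]_n) (e : R) : 0 <= e ->
  (`|v| <= e) <-> (forall k, `|v ord0 k| <= e).
Proof.
move=> e0; rewrite {1}/Num.Def.normr /= mx_normrE; split=> [vle k|vle].
  by apply: le_trans vle; apply/bigmax_geP; right; exists (ord0, k).
by apply: bigmax_le => // -[i k] _ /=; rewrite ord1.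
Qed.

(* Joins the complete and normed structures of matrices, which the library
   declares separately. *)
HB.instance Definition _ (R : realType) m n := Uniform.on 'M[R]_(m, n).

(** The map v - G v at least halves distances and has norm at most 1/2 at 0, so it maps the unit
    ball to itself; its fixed point is a zero of G. *)
Lemma contraction_zero (R : realType) n (G : 'rV[R]_n -> 'rV[R]_n) :
  (forall v w, `|v| <= 1 -> `|w| <= 1 ->
     `|v - w - (G v - G w)| <= 2^-1 * `|v - w|) ->
  `|G 0| <= 2^-1 -> exists2 v, `|v| <= 1 & G v = 0.
Proof.
move=> Gc G0; pose U := [set v : 'rV[R]_n | `|v| <= 1].
pose f v := v - G v.
have fU : {homo f : v / U v}.
  move=> v /= v1.
  have -> : f v = (v - 0 - (G v - G 0)) - G 0.
    by rewrite /f subr0 -addrA -opprD subrK.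
  apply: le_trans (ler_normB _ _) _.
  have := Gc v 0 v1; rewrite normr0 ler01 => /(_ isT); rewrite subr0 => h.
  by rewrite /U /= in v1 *; lra.
have half0 : 0 <= 2^-1 :> R by rewrite invr_ge0.
have [|||v v1 vE] := @banach_fixed_point R 'rV[R]_n U (mkfun fU).
- exists (NngNum half0); split => /=; first by rewrite invf_lt1 ?ltr1n.
  move=> [v w] /= [v1 w1]; rewrite /mkfun /f.
  have -> : v - G v - (w - G w) = v - w - (G v - G w).
    by rewrite !opprB addrACA [RHS]addrACA [- G v - w]addrC.
  exact: Gc.
- rewrite (_ : U = closed_ball (0 : 'rV[R]_n) 1).
    exact: closed_ball_closed.
  rewrite closed_ballE//; apply/seteqP.
  by split=> v; rewrite /closed_ball_ /= sub0r normrN.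
- by exists 0; rewrite /U /= normr0.
- exists v => //; move: vE; rewrite /mkfun /f => /eqP.
  by rewrite -subr_eq0 opprB addrC subrK => /eqP.
Qed.

(** * Quintic systems near an approximate solution *)

Lemma expr_mul_le (R : realFieldType) (l s u r : R) i j : 0 <= l ->
  l <= s <= r -> l <= u <= r -> l ^+ (i + j) <= s ^+ i * u ^+ j <= r ^+ (i + j).
Proof.
move=> l0 /andP[ls sr] /andP[lu ur]; rewrite !exprD.
have s0 := le_trans l0 ls; have u0 := le_trans l0 lu.
by apply/andP; split; apply: ler_pM; rewrite ?exprn_ge0// lerXn2r// nnegrE
  (le_trans _ sr, le_trans _ ur).
Qed.

(** Dividing s ^ 5 - u ^ 5 by s - u leaves five monomials of degree 4, each between (g - h) ^ 4 and
    (g + h) ^ 4. *)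
Lemma expr5_taylor1 (R : realFieldType) (g h s u : R) :
  h <= g -> `|s - g| <= h -> `|u - g| <= h ->
  `|s ^+ 5 - u ^+ 5 - 5 * g ^+ 4 * (s - u)|
    <= 5 * ((g + h) ^+ 4 - g ^+ 4) * `|s - u|.
Proof.
move=> hg sg ug; have h0 : 0 <= h by apply: le_trans sg.
have sb : g - h <= s <= g + h by rewrite -ler_distl.
have ub : g - h <= u <= g + h by rewrite -ler_distl.
have l0 : 0 <= g - h by rewrite subr_ge0.
have B i j := @expr_mul_le R _ s u _ i j l0 sb ub.
have /andP[a1 b1] := B 4%N 0%N; have /andP[a2 b2] := B 3%N 1%N.
have /andP[a3 b3] := B 2%N 2%N; have /andP[a4 b4] := B 1%N 3%N.
have /andP[a5 b5] := B 0%N 4%N.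
have -> : s ^+ 5 - u ^+ 5 - 5 * g ^+ 4 * (s - u)
  = (s ^+ 4 * u ^+ 0 + s ^+ 3 * u ^+ 1 + s ^+ 2 * u ^+ 2 + s ^+ 1 * u ^+ 3
     + s ^+ 0 * u ^+ 4 - 5 * g ^+ 4) * (s - u) by ring.
rewrite normrM ler_wpM2r// ler_norml.
(* By convexity the upper deviation from g ^ 4 dominates the lower one, so one bound serves both
   signs. *)
have : 2 * g ^+ 4 <= (g + h) ^+ 4 + (g - h) ^+ 4.
  have -> : (g + h) ^+ 4 + (g - h) ^+ 4
    = 2 * g ^+ 4 + 12 * (g ^+ 2 * h ^+ 2) + 2 * h ^+ 4 by ring.
  have : 0 <= g ^+ 2 * h ^+ 2 by rewrite mulr_ge0 ?sqr_ge0.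
  have : 0 <= h ^+ 4 by rewrite exprn_ge0.
  lra.
move: a1 b1 a2 b2 a3 b3 a4 b4 a5 b5; rewrite /addn /= => *.
by apply/andP; split; lra.
Qed.

(* A triple (a, b, m) encodes the summand m (x_a - x_b) ^ 5. The solution is
   sought in the form x_a = c_a + \sum_l v_l N_l,a with |v_l| <= 1; the last
   hypothesis says that N / sigma nearly inverts the Jacobian at c, with a
   margin for its variation over the ball. *)
Section Solve.
Variables (R : realType) (K : nat) (e : 'I_K -> seq (nat * nat * nat)).
Variables (c : nat -> R) (N : 'I_K -> nat -> R) (sigma T rho : R).
Let gap (x : nat -> R) (t : nat * nat * nat) : R := x t.1.1 - x t.1.2.
Let NB l (t : nat * nat * nat) : R := N l t.1.1 - N l t.1.2.

Lemma quintic_system_solvable :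
  0 < sigma ->
  (forall a, \sum_l `|N l a| <= rho) ->
  (forall k t, t \in e k -> 2 * rho <= gap c t) ->
  (forall k, 2 * `|\sum_(t <- e k) t.2%:R * gap c t ^+ 5 - T| <= sigma) ->
  (forall k, 2 * (\sum_l `|sigma *+ (l == k)
          - \sum_(t <- e k) t.2%:R * (5 * gap c t ^+ 4) * NB l t|
     + \sum_(t <- e k) t.2%:R * (10 * rho)
          * ((gap c t + 2 * rho) ^+ 4 - gap c t ^+ 4)) <= sigma) ->
  exists x : nat -> R, forall k,
    (forall t, t \in e k -> x t.1.2 <= x t.1.1) /\
    \sum_(t <- e k) t.2%:R * gap x t ^+ 5 = T.
Proof.
move=> s0 Nrho rhogap resid contr.
have rho0 : 0 <= rho by apply: le_trans (Nrho 0%N); exact: sumr_ge0.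
pose X (v : 'rV[R]_K) a : R := c a + \sum_l v ord0 l * N l a.
pose F (x : nat -> R) k := \sum_(t <- e k) t.2%:R * gap x t ^+ 5.
(* The directions N already carry the approximate inverse Jacobian, so dividing by sigma makes the
   derivative of G close to the identity. *)
pose G (v : 'rV[R]_K) : 'rV[R]_K := \row_k (sigma^-1 * (F (X v) k - T)).
have gapX (v : 'rV[R]_K) t : gap (X v) t = gap c t + \sum_l v ord0 l * NB l t.
  rewrite /gap /X /NB (eq_bigr _ (fun _ _ => mulrBr _ _ _)) sumrB; ring.
have NBle (v : 'rV[R]_K) b t : `|v| <= b -> 
    `|\sum_l v ord0 l * NB l t| <= 2 * rho * b.
  move=> vb; have b0 : 0 <= b by apply: le_trans vb.
  have vl := (rowv_norm_le v b0).1 vb.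
  apply: le_trans (ler_norm_sum _ _ _) _.
  apply: le_trans (_ : \sum_l (b * `|N l t.1.1| + b * `|N l t.1.2|) <= _).
    apply: ler_sum => l _; rewrite normrM -mulrDr.
    by apply: ler_pM => //; rewrite ler_normB.
  rewrite big_split /= -!mulr_sumr.
  have := Nrho t.1.1; have := Nrho t.1.2; nra.
have gapXd (v : 'rV[R]_K) t : `|v| <= 1 -> `|gap (X v) t - gap c t| <= 2 * rho.
  by move=> v1; rewrite gapX addrC addKr; have := NBle v 1 t v1; rewrite mulr1.
(* Gaps keep their sign on the whole ball; this later removes the absolute values in the
   distances. *)
have gap_ge0 (v : 'rV[R]_K) k t : `|v| <= 1 -> t \in e k -> 0 <= gap (X v) t.
  move=> v1 /rhogap; have := gapXd v t v1; rewrite ler_distl => /andP[]; lra.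
have [v v1 Gv0] : exists2 v, `|v| <= 1 & G v = 0.
  apply: contraction_zero; last first.
    apply/rowv_norm_le => [|k]; first by rewrite invr_ge0.
    rewrite mxE normrM gtr0_norm ?invr_gt0// ler_pdivrMl//.
    have -> : F (X 0) k = \sum_(t <- e k) t.2%:R * gap c t ^+ 5.
      apply: eq_bigr => t _; rewrite gapX big1 ?addr0// => l _.
      by rewrite mxE mul0r.
    have := resid k; lra.
  move=> v w v1 w1; apply/rowv_norm_le; first by rewrite mulr_ge0 ?invr_ge0.
  move=> k; set d := v - w; set b := `|d|.
  have b0 : 0 <= b by rewrite normr_ge0.
  have db := (rowv_norm_le d b0).1 (lexx _).
  pose D t := \sum_l d ord0 l * NB l t.
  have DE t : gap (X v) t - gap (X w) t = D t.
    rewrite !gapX opprD addrACA subrr add0r -sumrB.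
    by apply: eq_bigr => l _; rewrite !mxE mulrBl.
  pose r := \sum_(t <- e k) t.2%:R
    * (gap (X v) t ^+ 5 - gap (X w) t ^+ 5 - 5 * gap c t ^+ 4 * D t).
  pose M l := sigma *+ (l == k)
          - \sum_(t <- e k) t.2%:R * (5 * gap c t ^+ 4) * NB l t.
  have FE : F (X v) k - F (X w) k
      = \sum_(t <- e k) t.2%:R * (5 * gap c t ^+ 4) * D t + r.
    by rewrite /F /r -sumrB -big_split; apply: eq_bigr => t _ /=; ring.
  have ME : \sum_l d ord0 l * M l
      = sigma * d ord0 k - \sum_(t <- e k) t.2%:R * (5 * gap c t ^+ 4) * D t.
    under eq_bigr do rewrite mulrBr.
    rewrite sumrB; congr (_ - _).
      rewrite (bigD1 k)//= eqxx mulr1n big1 ?addr0 1?mulrC// => l /negPf ->.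
      by rewrite mulr0n mulr0.
    under eq_bigr do rewrite mulr_sumr.
    rewrite exchange_big; apply: eq_bigr => t _ /=.
    by rewrite mulr_sumr; apply: eq_bigr => l _; ring.
  (* The error splits into the defect M of the approximate inverse at c and the nonlinear remainder
     r. *)
  have -> : (d - (G v - G w)) ord0 k = sigma^-1 * (\sum_l d ord0 l * M l - r).
    have -> : r = F (X v) k - F (X w) k
        - \sum_(t <- e k) t.2%:R * (5 * gap c t ^+ 4) * D t by rewrite FE; ring.
    by rewrite ME !mxE; field; rewrite gt_eqF.
  rewrite normrM gtr0_norm ?invr_gt0// ler_pdivrMl//.
  have h1 : `|\sum_l d ord0 l * M l| <= b * \sum_l `|M l|.
    apply: le_trans (ler_norm_sum _ _ _) _; rewrite mulr_sumr.
    by apply: ler_sum => l _; rewrite normrM ler_wpM2r.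
  (* Here [10 * rho] is the 5 of the Taylor bound times the factor of b in
     [|D t| <= 2 * rho * b]. *)
  have h2 : `|r| <= b * \sum_(t <- e k) t.2%:R * (10 * rho)
          * ((gap c t + 2 * rho) ^+ 4 - gap c t ^+ 4).
    apply: le_trans (ler_norm_sum _ _ _) _; rewrite mulr_sumr.
    rewrite big_seq [leRHS]big_seq; apply: ler_sum => t te.
    rewrite normrM normr_nat [leRHS]mulrC -!(mulrA t.2%:R) ler_wpM2l// -DE.
    apply: le_trans
      (expr5_taylor1 (rhogap _ _ te) (gapXd _ _ v1) (gapXd _ _ w1)) _.
    rewrite DE; have := NBle d b t (lexx _); rewrite -/(D t).
    have : 0 <= (gap c t + 2 * rho) ^+ 4 - gap c t ^+ 4.
      have gr := rhogap _ _ te; rewrite subr_ge0 lerXn2r ?nnegrE//; lra.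
    nra.
  have := contr k; rewrite -/(M _).
  have := ler_normB (\sum_l d ord0 l * M l) r.
  nra.
exists (X v) => k; split.
  by move=> t /(gap_ge0 v k t v1); rewrite subr_ge0.
move/rowP/(_ k): Gv0; rewrite !mxE => /eqP.
by rewrite mulf_eq0 invr_eq0 gt_eqF//= subr_eq0 => /eqP.
Qed.
End Solve.

(** * Numerical data and the pattern of the points *)

Local Open Scope Z_scope.

(* A numerical solution of the twelve equations, times 10 ^ 9. *)
Definition centre : seq Z := [::
  0; 532634226; 981398220; 1505904588; 1631499585; 1797463080; 1889342737;
  0; 574445340; 805183222; 1156898275; 1552103035; 1804761502; 1906925288].

(* scaleZ times the inverse of the Jacobian at centre with respect to the
   variables other than x_0 and x_7, rounded. Since x_0, ..., x_6 and
   x_7, ..., x_13 are never compared with each other, x_0 and x_7 may be kept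
   fixed. *)
Definition direction : seq (seq Z) := [::
  [:: 0; -125; -254; -80; -171; -106; -31; 0; 120; 136; 545; 184; 136; 10];
  [:: 0; -344; -725; -158; -405; -290; -98; 0; 235; 253; 1168; 361; 254; -69];
  [:: 0; 231; 415; 153; 307; 177; 47; 0; -213; -247; -982; -335; -247; 58];
  [:: 0; 714; 1451; 392; 901; 593; 185; 0; -490; -555; -2431; -804; -557; 144];
  [:: 0; -101; -202; -49; -119; -82; -27; 0; 78; 85; 235; 118; 86; -14];
  [:: 0; 48; 224; -8; 57; 80; 39; 0; -27; -11; -122; -20; -11; 7];
  [:: 0; -120; -215; -73; -162; -91; 16; 0; 119; 134; 539; 177; 134; -32];
  [:: 0; -41; -72; 33; -53; -39; -9; 0; 27; 11; 149; 47; 11; -9];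
  [:: 0; -284; -514; -233; -360; -227; -60; 0; 202; 261; 990; 389; 261; -59];
  [:: 0; 84; 144; 47; 99; 76; 17; 0; -67; -39; -193; -105; -39; 11];
  [:: 0; -54; -255; 9; -65; -52; -44; 0; 30; 12; 139; 23; 13; -8];
  [:: 0; 5; 24; -1; 6; 0; 4; 0; -3; -23; -13; -2; -1; 1]].

Definition scaleZ : Z := 3 * 10 ^ 39.
(** The fifth power 28 of the common distance, times (10 ^ 9) ^ 5 to match [centre]. *)
Definition targetZ : Z := 28 * 10 ^ 45.
(** Bounds how far each x_a may move from [centre]. *)
Definition radiusZ : Z := 8000.

Local Close Scope Z_scope.

(** Each list describes a kind of pair of points: (a, b, m) records m coordinates where the two
    points take the values x_a and x_b, in either order. Coordinates where they agree are left
    out. *)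
Definition profiles : seq (seq (nat * nat * nat)) := [::
  [:: (10, 7, 1); (13, 7, 1); (13, 10, 3)];
  [:: (4, 1, 14); (10, 7, 2); (13, 10, 6)];
  [:: (1, 0, 1); (2, 1, 3); (4, 2, 9); (4, 3, 3); (6, 1, 3); (8, 7, 1);
      (10, 8, 3); (11, 10, 21); (13, 8, 3)];
  [:: (2, 1, 3); (3, 1, 1); (4, 0, 1); (4, 1, 3); (4, 2, 9);
      (4, 3, 2); (6, 4, 3); (10, 8, 7); (11, 7, 1); (11, 10, 17); (13, 11, 3)];
  [:: (3, 1, 7); (4, 3, 21); (12, 7, 1); (12, 10, 24); (13, 12, 3)];
  [:: (5, 1, 7); (5, 4, 21); (9, 7, 1); (10, 9, 24); (13, 9, 3)];
  [:: (2, 0, 1); (3, 2, 3); (4, 2, 9); (4, 3, 3); (6, 0, 1); (6, 2, 3)];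
  [:: (3, 0, 2); (6, 4, 6); (11, 8, 14)];
  [:: (2, 0, 1); (3, 2, 3); (4, 0, 1); (4, 2, 9); (4, 3, 2);
      (6, 2, 3); (6, 3, 1); (6, 4, 2); (11, 8, 14)];
  [:: (3, 0, 1); (3, 2, 12); (4, 3, 9); (6, 3, 3); (12, 8, 7); (12, 11, 21)];
  [:: (5, 0, 1); (5, 2, 12); (5, 3, 3); (5, 4, 9); (6, 5, 3); (9, 8, 7);
      (11, 9, 21)];
  [:: (5, 3, 28); (12, 9, 28)]]%N.

(* The columns are split into two halves of 4 x 7; so are the first 56 rows,
   into two kinds of 4 x 7 points. An entry depends on the halves, on whether
   the block indices agree, and on whether the difference s of the residues
   mod 7 is 0, a nonzero square or a nonsquare. The last two rows are constant
   on each half. *)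
Definition entry (i j : nat) : nat :=
  let left := (j < 28)%N in
  let same := ((i %/ 7) %% 4 == (j %/ 7) %% 4)%N in
  let s := nth 0%N [:: 0; 1; 1; 2; 1; 2; 2]%N ((7 + j %% 7 - i %% 7) %% 7)%N in
  if (i < 28)%N then
    if left then (if same then 1 else 4)%N
    else if same then nth 0%N [:: 7; 10; 13]%N s else 10%N
  else if (i < 56)%N then
    if left then nth 0%N (if same then [:: 0; 2; 6] else [:: 3; 2; 4])%N s
    else (if same then 8 else 11)%N
  else if i == 56%N then (if left then 3 else 12)%N
  else (if left then 5 else 9)%N.

Definition table := [seq [seq entry i j | j <- iota 0 56] | i <- iota 0 58].

(* Within each half the values increase with the index, so the larger index of
   each pair comes first. *)
Definition differences (u v : seq nat) : seq (nat * nat) :=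
  [seq (maxn p.1 p.2, minn p.1 p.2) | p <- zip u v & p.1 != p.2].

(** The three tests together say that [e] lists the elements of [s] with their multiplicities. *)
Definition has_profile (s : seq (nat * nat)) (e : seq (nat * nat * nat)) :=
  [&& uniq [seq t.1 | t <- e], all (mem [seq t.1 | t <- e]) s &
      all (fun t => count_mem t.1 s == t.2) e].

Lemma table_profiles :
  pairwise (fun u v => has (has_profile (differences u v)) profiles) table.
Proof. by vm_compute. Qed.

(** * Integer certificates for the error bounds *)

Definition sumZ : seq Z -> Z := foldr +%R 0.

Definition gapZ (t : nat * nat * nat) : Z := centre`_t.1.1 - centre`_t.1.2.

Definition dirZ (l a : nat) : Z := (nth [::] direction l)`_a.

(** This check and the next three give the numerical hypotheses of [quintic_system_solvable], over
    the integers so that they evaluate exactly. *)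
Lemma certificate_direction :
  all (fun a => sumZ [seq `|dirZ l a| | l <- iota 0 12] <= radiusZ) (iota 0 14).
Proof. by vm_compute. Qed.

Lemma certificate_gap :
  all (all (fun t => 2 * radiusZ <= gapZ t)) profiles.
Proof. by vm_compute. Qed.

Lemma certificate_residual :
  all (fun e => 2 * `|sumZ [seq t.2%:R * gapZ t ^+ 5 | t <- e] - targetZ|
                  <= scaleZ) profiles.
Proof. by vm_compute. Qed.

Lemma certificate_contraction :
  all (fun k => let e := nth [::] profiles k in
    2 * (sumZ [seq `|scaleZ *+ (l == k)
             - sumZ [seq t.2%:R * (5 * gapZ t ^+ 4)
                         * (dirZ l t.1.1 - dirZ l t.1.2) | t <- e]|
           | l <- iota 0 12]
       + sumZ [seq t.2%:R * (10 * radiusZ)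
                   * ((gapZ t + 2 * radiusZ) ^+ 4 - gapZ t ^+ 4) | t <- e])
      <= scaleZ) (iota 0 12).
Proof. by vm_compute. Qed.

Lemma scaleZ_gt0 : 0 < scaleZ.
Proof. by []. Qed.

Lemma radiusZ_ge0 : 0 <= radiusZ.
Proof. by []. Qed.

(** The bound by [radiusZ] is required for every natural a; past the 14 variables the default 0
    satisfies it. *)
Lemma dirZ_default l a : (14 <= a)%N -> dirZ l a = 0.
Proof.
move=> a14; rewrite /dirZ.
have [ls|sl] := ltnP l (size direction); last first.
  by rewrite (nth_default [::]) ?nth_nil.
have sizes : all (fun r => size r == 14%N) direction by [].
have /eqP sz := allP sizes _ (mem_nth [::] ls).
by rewrite nth_default ?sz.
Qed.

#[local] Opaque scaleZ targetZ radiusZ gapZ dirZ.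

(** * Transfer of the certificates to the reals *)

Section ZtoR.
Variable R : realType.

Definition ZtoR : Z -> R := intr \o int_of_Z.

HB.instance Definition _ := GRing.RMorphism.on ZtoR.

Let ZtoRM a b : ZtoR (a * b) = ZtoR a * ZtoR b. Proof. exact: rmorphM. Qed.
Let ZtoRD a b : ZtoR (a + b) = ZtoR a + ZtoR b. Proof. exact: rmorphD. Qed.
Let ZtoRB a b : ZtoR (a - b) = ZtoR a - ZtoR b. Proof. exact: rmorphB. Qed.
Let ZtoRX a k : ZtoR (a ^+ k) = ZtoR a ^+ k. Proof. exact: rmorphXn. Qed.
Let ZtoRMn a k : ZtoR (a *+ k) = ZtoR a *+ k. Proof. exact: rmorphMn. Qed.
Let ZtoR1 : ZtoR 1 = 1. Proof. exact: rmorph1. Qed.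
Let ZtoRE := (ZtoRMn, ZtoRX, ZtoRB, ZtoRD, ZtoRM, ZtoR1).

Lemma ler_ZtoR : {mono ZtoR : a b / a <= b}.
Proof.
move=> a b; rewrite /ZtoR /= ler_int.
by apply/idP/idP; lia.
Qed.

Lemma ZtoR_norm a : ZtoR `|a| = `|ZtoR a|.
Proof.
rewrite /ZtoR /= -intr_norm; congr (_%:~R); lia.
Qed.

Lemma ZtoR_sumZ T (f : T -> Z) (s : seq T) :
  ZtoR (sumZ [seq f t | t <- s]) = \sum_(t <- s) ZtoR (f t).
Proof. by rewrite /sumZ foldrE big_map rmorph_sum. Qed.

Lemma sum_ord_iota n (f : nat -> R) :
  \sum_(l < n) f l = \sum_(l <- iota 0 n) f l.
Proof. by rewrite -(big_mkord xpredT f) /index_iota subn0. Qed.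

Lemma profiles_solvable : exists x : nat -> R, forall e, e \in profiles ->
  (forall t, t \in e -> x t.1.2 <= x t.1.1) /\
  \sum_(t <- e) t.2%:R * (x t.1.1 - x t.1.2) ^+ 5 = ZtoR targetZ.
Proof.
pose e (k : 'I_12) := nth [::] profiles k.
have ep k : e k \in profiles by apply: mem_nth; exact: ltn_ord.
have gapE t : ZtoR centre`_t.1.1 - ZtoR centre`_t.1.2 = ZtoR (gapZ t).
  by rewrite -ZtoRB.
have [|||||x xP] := @quintic_system_solvable R 12 e (fun a => ZtoR centre`_a)
  (fun l a => ZtoR (dirZ l a)) (ZtoR scaleZ) (ZtoR targetZ) (ZtoR radiusZ).
- by rewrite -[0]/(ZtoR 0) (leW_mono ler_ZtoR) scaleZ_gt0.
- move=> a; rewrite (sum_ord_iota _ (fun l => `|ZtoR (dirZ l a)|)).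
  under eq_bigr do rewrite -ZtoR_norm.
  rewrite -ZtoR_sumZ ler_ZtoR.
  have [a14|a14] := ltnP a 14.
    by have /allP/(_ a) := certificate_direction; rewrite mem_iota; exact.
  rewrite (_ : sumZ _ = 0) ?radiusZ_ge0// /sumZ foldrE big_map big1// => l _.
  by rewrite dirZ_default// normr0.
- move=> k t te; have /allP/(_ _ (ep k))/allP/(_ t te) := certificate_gap.
  by rewrite gapE -ler_ZtoR !ZtoRE.
- move=> k; have /allP/(_ _ (ep k)) := certificate_residual.
  rewrite -ler_ZtoR ZtoRM ZtoR_norm ZtoRB ZtoR_sumZ !ZtoRE.
  by under eq_bigr do rewrite !ZtoRE -?gapE.
- move=> k; have /allP/(_ (k : nat)) := certificate_contraction.
  rewrite mem_iota ltn_ord => /(_ isT); lazy beta zeta; rewrite -/(e k).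
  rewrite -ler_ZtoR ZtoRM (ZtoRD (sumZ _)) !ZtoR_sumZ !ZtoRE.
  rewrite -(sum_ord_iota 12 (fun l => ZtoR _)).
  under eq_bigr do rewrite ZtoR_norm !ZtoRE ZtoR_sumZ.
  under eq_bigr do under eq_bigr do rewrite !ZtoRE -?gapE.
  by under [X in _ + X]eq_bigr do rewrite !ZtoRE -?gapE.
exists x => e0 /(nthP [::])[k k12 <-]; exact: (xP (Ordinal k12)).
Qed.
End ZtoR.

(** * From the solved equations to the 58 points *)

Section Configuration.
Variable R : realType.

Lemma profile_sum (phi : nat * nat -> R) s e : has_profile s e ->
  \sum_(p <- s) phi p = \sum_(t <- e) t.2%:R * phi t.1.
Proof.
case/and3P => ue /allP se /allP ce.
(* Double counting: by uniqueness each p matches exactly one triple, and each triple matches t.2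
   elements of s. *)
transitivity (\sum_(p <- s) \sum_(t <- e) (t.1 == p)%:R * phi t.1).
  rewrite big_seq [RHS]big_seq; apply: eq_bigr => p /se /= /mapP[t te pE].
  rewrite -(big_map (fun t => t.1) xpredT (fun q => (q == p)%:R * phi q)).
  rewrite (bigD1_seq p) ?pE ?map_f//= -pE eqxx mul1r big1 ?addr0//.
  move=> q /negPf ->.
  by rewrite mul0r.
rewrite exchange_big big_seq [RHS]big_seq; apply: eq_bigr => t te.
rewrite -mulr_suml -(eqP (ce t te)) -sum1_count natr_sum [in RHS]big_mkcond /=.
by congr (_ * _); apply: eq_bigr => p _; rewrite eq_sym /=; case: eqP.
Qed.

(** Agreeing entries contribute 0, and the absolute value ignores the order within a pair. *)
Lemma differences_sum (x : nat -> R) (f g : nat -> nat) n :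
  \sum_(r < n) `|x (f r) - x (g r)| ^+ 5 =
  \sum_(p <- differences [seq f r | r <- iota 0 n] [seq g r | r <- iota 0 n])
     `|x p.1 - x p.2| ^+ 5.
Proof.
rewrite (sum_ord_iota n (fun r => `|x (f r) - x (g r)| ^+ 5)) /differences.
elim: (iota 0 n) => [|r s IH] /=; first by rewrite !big_nil.
rewrite big_cons IH; case: eqVneq => [->|fg] /=.
  by rewrite subrr normr0 expr0n add0r.
rewrite big_cons; congr (_ + _); congr (_ ^+ _).
by case: (leqP (f r) (g r)) => // _; rewrite distrC.
Qed.

Lemma configuration_exists : exists (T : R) (x : 'I_58 -> 'rV[R]_56),
  0 < T /\ forall i j : 'I_58, (i < j)%N ->
    \sum_r `|(x i - x j) ord0 r| ^+ 5 = T.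
Proof.
have [x xP] := profiles_solvable R.
exists (ZtoR R targetZ), (fun i => \row_j x (entry i j)); split.
  by rewrite -[0]/(ZtoR R 0) (leW_mono (ler_ZtoR R)).
move=> i j ij; under eq_bigr do rewrite !mxE.
rewrite (differences_sum x (entry i) (entry j)).
have /(pairwiseP [::])/(_ i j) := table_profiles.
rewrite !inE size_map size_iota !(nth_map 0%N) ?size_iota ?ltn_ord//.
rewrite !nth_iota ?ltn_ord//.
rewrite !add0n => /(_ isT isT ij)/hasP[e /xP[xe <-]].
move=> /profile_sum ->; rewrite big_seq [RHS]big_seq; apply: eq_bigr => t te.
by rewrite ger0_norm// subr_ge0 xe.
Qed.

End Configuration.

(** * Consequences for equilateral sets *)

Lemma equilateral_card_le_e_lp (R : realType) n (p : R) (A : set 'rV[R]_n) m :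
  0 < p -> equilateral (lpnorm p) A -> A #= `I_m -> (m <= e_lp n p)%N.
Proof.
move=> p0 eA Am; have [_ /(_ _ eA)] := equilateral_numberP n p0.
by rewrite (card_le_eql Am) card_le_II.
Qed.

Lemma lpnorm5E (R : realType) n (x : 'rV[R]_n) :
  lpnorm 5 x = (\sum_r `|x ord0 r| ^+ 5) `^ 5^-1.
Proof.
by rewrite /lpnorm; congr (_ `^ _); apply: eq_bigr => r _; rewrite powR_mulrn.
Qed.

Theorem theorem1 (R : realType) :
  [/\ exists A : set 'rV[R]_56, equilateral (lpnorm 5) A /\ A #= `I_58,
      exists x : 'I_58 -> 'rV[R]_56,
        injective x /\
        exists d : R, forall i j : 'I_58,
          (i < j)%N -> lpnorm 5 (x i - x j) = d,
      (56 + 1 < 58 <= e_lp 56 (5 : R))%N &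
      ~ (forall (n : nat) (p : R), (0 < n)%N -> 2 < p -> e_lp n p = (n + 1)%N)].
Proof.
have [T [x [T0 xT]]] := configuration_exists R.
have xN i j : i != j -> \sum_r `|(x i - x j) ord0 r| ^+ 5 = T.
  rewrite neq_ltn => /orP[/xT//|/xT <-]; apply: eq_bigr => r _.
  by rewrite -opprB mxE normrN.
have xinj : injective x.
  move=> i j xij; apply/eqP; apply: contraT => /xN.
  rewrite xij subrr big1 => [T_eq0|r _]; last by rewrite mxE normr0 expr0n.
  by rewrite -T_eq0 ltxx in T0.
have eqA : exists A : set 'rV[R]_56, equilateral (lpnorm 5) A /\ A #= `I_58.
  exists (range x); split.
    exists (T `^ 5^-1) => _ _ [i _ <-] [j _ <-] xij; rewrite lpnorm5E xN//.
    by apply: contra_notN xij => /eqP ->.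
  apply: card_eq_trans (inj_card_eq (in2W xinj)) _.
  by rewrite card_eq_sym; exact: card_II.
have e58 : (58 <= e_lp 56 (5 : R))%N.
  by have [A [eA A58]] := eqA; apply: equilateral_card_le_e_lp eA A58.
split=> //.
- exists x; split=> //; exists (T `^ 5^-1) => i j ij.
  by rewrite lpnorm5E xT.
- move=> /(_ 56%N 5 isT); rewrite ltr_nat => /(_ isT) e57.
  by rewrite e57 in e58.
Qed.
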